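(* Let $f$ be a graph polynomial of bounded exponential type with bounding function $R:\mathbb{N}\to(0,\infty)$. Then there is an absolute constant $c<7.04$ such that for every $\Delta\in\mathbb{N}$ and every finite simple graph $G$ all of whose degrees are at most $\Delta$, every complex root $z$ of $f(G,z)$ satisfies $|z|<c\,R(\Delta)$.
   Context: All graphs are finite simple undirected graphs (the empty graph is allowed). A graph polynomial is a map $f$ assigning to each graph $G$ a polynomial $f(G,x)\in\mathbb{C}[x]$; it is monic if $f(G,x)$ is monic of degree $|V(G)|$ for all $G$. For $S\subseteq V(G)$, $G[S]$ is the induced subgraph on $S$, $f(S,x)=f(G[S],x)$ and $f(G-S,y)=f(G[V(G)\setminus S],y)$. $f$ is of exponential type if $f(\emptyset,x)=1$ and for every graph $G$, $\sum_{S\subseteq V(G)} f(S,x)f(G-S,y)=f(G,x+y)$. Writing $f(G,x)=\sum_{k=0}^{|V(G)|}a_k(G)x^k$, a monic graph polynomial $f$ of exponential type is of bounded exponential type with bounding function $R:\mathbb{N}\to[0,\infty)$ if for every graph $G$ with all degrees at most $\Delta$, every $v\in V(G)$ and every integer $t\ge 1$: $\sum_{S\subseteq V(G),\ v\in S,\ |S|=t}|a_1(G[S])|\le R(\Delta)^{t-1}$. *)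

(* Defs.v *)
From mathcomp Require Import all_boot all_order all_algebra.
From mathcomp Require Import finmap complex reals.

Set Implicit Arguments.
Unset Strict Implicit.
Unset Printing Implicit Defensive.

Import Order.TTheory GRing.Theory Num.Theory.

Local Open Scope ring_scope.
Local Open Scope complex_scope.
Local Open Scope fset_scope.

(* Finite simple graphs are set-theoretic objects (V, E), with vertices drawn
   from an arbitrary, possibly infinite type U and E a set of 2-element subsets
   of V.  Induced subgraphs are then again graphs over U, and G[S][T] = G[T] for
   T `<=` S, so that no invariance under isomorphism has to be required of a
   graph polynomial. *)
Record sgraph (U : choiceType) := SGraph {
  vset : {fset U};
  eset : {fset {fset U}};
  _ : all (fun e : {fset U} => (e `<=` vset) && (#|` e| == 2%N)) eset
}.

Section Graphs.
Variable U : choiceType.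
Implicit Types (G : sgraph U) (S : {fset U}) (v : U).

Lemma esetP G e : e \in eset G -> (e `<=` vset G) && (#|` e| == 2%N).
Proof. by case: G => V E /= /allP; apply. Qed.

Definition empty_graph : sgraph U := @SGraph U fset0 fset0 isT.

Fact induced_subproof G S :
  all (fun e : {fset U} => (e `<=` vset G `&` S) && (#|` e| == 2%N))
      [fset e in eset G | e `<=` S].
Proof.
apply/allP => e; rewrite !inE => /andP[/esetP/andP[eV ->] eS].
by rewrite fsubsetI eV eS.
Qed.

Definition induced G S : sgraph U := SGraph (induced_subproof G S).

Definition degree G v : nat := #|` [fset e in eset G | v \in e]|.

Definition degrees_le G (D : nat) : Prop :=
  forall v, v \in vset G -> (degree G v <= D)%N.

End Graphs.

Definition graph_polynomial (R : realType) (U : choiceType) :=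
  sgraph U -> {poly R[i]}.

Section GraphPolynomials.
Variables (R : realType) (U : choiceType).
Implicit Types (f : graph_polynomial R U) (rho : nat -> R).

Definition monic_graph_polynomial f : Prop :=
  forall G, f G \is monic /\ size (f G) = #|` vset G|.+1.

Definition exponential_type f : Prop :=
  f (empty_graph U) = 1 /\
  forall (G : sgraph U) (x y : R[i]),
    \sum_(S <- fpowerset (vset G))
      (f (induced G S)).[x] * (f (induced G (vset G `\` S))).[y]
    = (f G).[x + y].

Definition bounded_exponential_type f rho : Prop :=
  [/\ monic_graph_polynomial f,
      exponential_type f,
      forall D : nat, 0 <= rho D &
      forall (D : nat) (G : sgraph U), degrees_le G D ->
      forall v, v \in vset G ->
      forall t : nat, (1 <= t)%N ->
        \sum_(S <- fpowerset (vset G) | (v \in S) && (#|` S| == t))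
          `| (f (induced G S))`_1 | <= (rho D ^+ (t - 1))%:C].

End GraphPolynomials.

(* Main.v *)
Require Import Defs.
From mathcomp Require Import all_boot all_order all_algebra.
From mathcomp Require Import finmap complex reals.
From mathcomp Require Import ring.

Set Implicit Arguments.
Unset Strict Implicit.

Import Order.TTheory GRing.Theory Num.Theory.

Local Open Scope ring_scope.
Local Open Scope complex_scope.

(** Write [a_1(S)] for the linear coefficient of [f(G[S])].  Comparing derivatives
    in the exponential identity gives, for every vertex [v] of [G],
      [f(G, z) = z * \sum_(S | v \in S) a_1(S) f(G - S, z)],
    where the term [S = {v}] is [f(G - v, z)].  If removing one vertex from a
    smaller induced subgraph multiplies [|f|] by at most [k = 1 / ((1 - s) |z|)],
    the terms with [|S| >= 2] add up to at most
      [|f(G - v, z)| * \sum_(t >= 2) (k R)^(t - 1) <= s |f(G - v, z)|],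
    provided that [R (1 + s) <= s (1 - s) |z|]; the ratio bound is then inherited
    by [G], and no [f(G, z)] vanishes.  The value [s = 1/2] gives [c = 6]
    (the optimum [s = sqrt 2 - 1] would give [3 + 2 sqrt 2]). *)

(** * Polynomials and inequalities in characteristic zero *)

Section NumFieldPolynomials.
Variable C : numFieldType.
Implicit Types p q : {poly C}.

Lemma horner_ext p q : (forall x, p.[x] = q.[x]) -> p = q.
Proof.
move=> pq; apply/eqP; rewrite -subr_eq0; apply/eqP.
apply: (@roots_geq_poly_eq0 _ _ [seq n%:R | n <- iota 0 (size (p - q))]).
- by apply/allP => x _; rewrite rootE !hornerE pq subrr.
- by rewrite map_inj_uniq ?iota_uniq //; apply: mulrIn; apply: oner_neq0.
- by rewrite size_map size_iota.
Qed.

Lemma deriv_horner0_inj p q : p^`() = q^`() -> p.[0] = q.[0] -> p = q.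
Proof.
move=> dpq pq0; apply/polyP => -[|i]; first by rewrite -!horner_coef0.
have /eqP := congr1 (fun u : {poly C} => u`_i) dpq.
by rewrite !coef_deriv eqr_pMn2r // => /eqP.
Qed.

Lemma coef1_deriv0 p : p`_1 = p^`().[0].
Proof. by rewrite horner_coef0 coef_deriv mulr1n. Qed.

(** The hypothesis is [q / (1 - q) <= s] cleared of its denominator. It makes the induction close:
    the sum with one more term is [q] times one plus the previous sum. *)
Lemma geometric_tail_le (q s : C) n :
  0 <= q -> 0 <= s -> q * (1 + s) <= s -> \sum_(i < n) q ^+ i.+1 <= s.
Proof.
move=> q0 s0 qs; elim: n => [|n IHn]; first by rewrite big_ord0.
apply: le_trans qs; rewrite big_ord_recl expr1.
under eq_bigr do rewrite exprS.
by rewrite -mulr_sumr mulrDr mulr1 lerD2l ler_wpM2l.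
Qed.

(** For [s = 1/2] the smallness condition reads [(3/2) r <= (1/4) y]; this is where the constant 6
    arises. *)
Lemma half_scaled_le (r y : C) :
  6%:R * r <= y -> r * (1 + 2%:R^-1) <= 2%:R^-1 * (1 - 2%:R^-1) * y.
Proof.
have -> : r * (1 + 2%:R^-1) = 2%:R^-1 * (1 - 2%:R^-1) * (6%:R * r) by field.
apply: ler_wpM2l; rewrite mulr_ge0 ?invr_ge0 ?ler0n // subr_ge0.
by rewrite invf_le1 ?ltr0n // ler1n.
Qed.

End NumFieldPolynomials.

Local Open Scope fset_scope.

(** * Reindexing of powerset sums *)

Section PowersetSums.
Variables (A : nmodType) (U : choiceType).
Implicit Types (S T W : {fset U}) (h : {fset U} -> A).

Lemma big_fpowerset_sub W V (P : pred {fset U}) h : W `<=` V ->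
  \sum_(S <- fpowerset W | P S) h S =
  \sum_(S <- fpowerset V | P S && (S `<=` W)) h S.
Proof.
move=> WV; rewrite [LHS]big_fset_condE [RHS]big_fset_condE.
suff -> : [fset S in fpowerset W | P S] =
          [fset S in fpowerset V | P S && (S `<=` W)] by [].
apply/fsetP => S; rewrite !inE !fpowersetE.
case: (boolP (S `<=` W)) => [SW|]; last by rewrite !andbF.
by rewrite (fsubset_trans SW WV) andbT.
Qed.

Lemma big_fpowersetD W T (P : pred {fset U}) h :
  \sum_(S <- fpowerset (W `\` T) | P S) h S =
  \sum_(S <- fpowerset W | P S && [disjoint S & T]%fset) h S.
Proof.
rewrite (big_fpowerset_sub _ _ (fsubsetDl W T)) [LHS]big_seq_cond.
rewrite [RHS]big_seq_cond; apply: eq_bigl => S.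
rewrite fpowersetE; case: (boolP (S `<=` W)) => //= SW.
by rewrite fsubsetD SW.
Qed.

End PowersetSums.

(** * Set-indexed polynomial families of binomial type *)

Section BinomialFamily.
Variables (C : numFieldType) (U : choiceType).
Variables (F : {fset U} -> {poly C}) (V : {fset U}).
Implicit Types (S T W : {fset U}) (v : U).

Hypothesis F_fset0 : F fset0 = 1.
Hypothesis F_binomial : forall W, W `<=` V -> forall x y,
  \sum_(S <- fpowerset W) (F S).[x] * (F (W `\` S)).[y] = (F W).[x + y].

(** For fixed [y], both sides of [F_binomial] are polynomials in [x]; compare their coefficients of
    degree one. *)
Lemma binomial_deriv W : W `<=` V ->
  (F W)^`() = \sum_(S <- fpowerset W) (F S)`_1 *: F (W `\` S).
Proof.
move=> WV; apply: horner_ext => y.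
have E : \sum_(S <- fpowerset W) (F (W `\` S)).[y] *: F S
         = F W \Po ('X + y%:P).
  apply: horner_ext => x; rewrite horner_comp !hornerE -F_binomial //.
  by rewrite horner_sum; apply: eq_bigr => S _; rewrite hornerZ mulrC.
have := congr1 (fun p : {poly C} => p`_1) E.
rewrite [RHS]coef1_deriv0 deriv_comp derivD derivX derivC addr0 mulr1.
rewrite horner_comp hornerD hornerX hornerC add0r => <-.
rewrite coef_sum horner_sum; apply: eq_bigr => S _.
by rewrite coefZ hornerZ mulrC.
Qed.

Lemma binomial_horner0 W : W `<=` V -> W != fset0 -> (F W).[0] = 0.
Proof.
have [n] := ubnP #|` W|; elim: n W => // n IHn W; rewrite ltnS => leW WV W0.
have := F_binomial WV 0 0; rewrite addr0.
(* At [x = y = 0] the sets [fset0] and [W] each contribute [(F W).[0]], and all others vanish by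
   induction, so this value equals its double. *)
rewrite (big_fsetD1 fset0) ?fpowersetE ?fsub0set //=.
rewrite (big_fsetD1 W) ?inE ?fpowersetE ?fsubset_refl ?W0 //=.
rewrite fsetD0 fsetDv F_fset0 hornerC mul1r mulr1 big_seq big1 => [|S].
  by rewrite addr0 => /eqP; rewrite -subr_eq0 addrK => /eqP.
rewrite !inE fpowersetE => /and3P[SW S0 sSW].
rewrite IHn ?mul0r //; last exact: fsubset_trans WV.
by apply: leq_trans leW; rewrite fproper_ltn_card // fproperEneq SW.
Qed.

(* Both sides have the same derivative (expand each with [binomial_deriv] and
   exchange the two removed sets) and vanish at 0. *)
Lemma binomial_rooted W v : W `<=` V -> v \in W ->
  F W = 'X * \sum_(S <- fpowerset W | v \in S) (F S)`_1 *: F (W `\` S).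
Proof.
have [n] := ubnP #|` W|; elim: n W => // n IHn W; rewrite ltnS => leW WV vW.
have W0 : W != fset0 by apply/fset0Pn; exists v.
apply: deriv_horner0_inj; last first.
  by rewrite binomial_horner0 // hornerM hornerX mul0r.
rewrite derivM derivX mul1r raddf_sum /= binomial_deriv //.
(* The sets containing [v] match the first term of the product rule. The others must give ['X] times
   the derivative of the sum; both are rewritten over disjoint pairs. *)
rewrite (bigID (fun S => v \in S)) /=; congr (_ + _)%R.
transitivity ('X * \sum_(T <- fpowerset W | v \notin T)
    \sum_(S <- fpowerset W | (v \in S) && [disjoint S & T]%fset)
      (F S)`_1 * (F T)`_1 *: F (W `\` (S `|` T))).
  rewrite mulr_sumr [LHS]big_seq_cond [RHS]big_seq_cond.
  apply: eq_bigr => T /andP[]; rewrite fpowersetE => TW vT.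
  (* Induction needs [T] nonempty; for [T = fset0] the coefficient is zero, since [F fset0] is
     constant. *)
  have [->|T0] := eqVneq T fset0.
    rewrite F_fset0 coefC scale0r big1 ?mulr0 // => S _.
    by rewrite mulr0 scale0r.
  rewrite [in LHS](IHn (W `\` T)) ?inE ?vT //; first last.
  - exact: fsubset_trans (fsubsetDl _ _) WV.
  - apply: leq_trans leW; rewrite cardfsDS // -subn_gt0 subKn.
      by rewrite cardfs_gt0.
    exact: fsubset_leq_card.
  rewrite scalerAr big_fpowersetD scaler_sumr; congr (_ * _).
  by apply: eq_bigr => S _; rewrite scalerA mulrC fsetDDl fsetUC.
congr (_ * _); rewrite (exchange_big_dep (fun S => v \in S)) /=; last first.
  by move=> T S _ /andP[].
rewrite [LHS]big_seq_cond [RHS]big_seq_cond.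
apply: eq_bigr => S /andP[]; rewrite fpowersetE => SW vS.
rewrite derivZ binomial_deriv; last exact: fsubset_trans (fsubsetDl _ _) WV.
rewrite big_fpowersetD scaler_sumr; apply: eq_big => T.
  rewrite vS /= fdisjoint_sym; case: (boolP [disjoint T & S]%fset) => // dTS.
    rewrite andbT; apply: contraTN dTS => vT.
    by apply/fdisjointP => /(_ v vT); rewrite vS.
  by rewrite andbF.
by move=> _; rewrite scalerA fsetDDl.
Qed.

(** * The zero-free region *)

Section ZeroFree.
Variables (r z s : C).
Hypothesis F_fset1 : forall v, v \in V -> (F [fset v])`_1 = 1.
Hypothesis r_gt0 : 0 < r.
Hypothesis F_bound : forall v, v \in V -> forall t, (1 <= t)%N ->
  \sum_(S <- fpowerset V | (v \in S) && (#|` S| == t)) `|(F S)`_1|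
    <= r ^+ (t - 1).
Hypotheses (s_ge0 : 0 <= s) (s_lt1 : s < 1).
Hypothesis r_le : r * (1 + s) <= s * (1 - s) * `|z|.

Let k := ((1 - s) * `|z|)^-1.

Lemma zero_free_norm_gt0 : 0 < `|z|.
Proof.
rewrite normr_gt0; apply: contraTneq r_le => ->.
by rewrite normr0 mulr0 lt_geF // mulr_gt0 // ltr_pwDl.
Qed.

Let d_gt0 : 0 < (1 - s) * `|z|.
Proof. by rewrite mulr_gt0 ?zero_free_norm_gt0 ?subr_gt0. Qed.

Let k_ge0 : 0 <= k. Proof. by rewrite invr_ge0 ltW. Qed.

Let kr_le : k * r * (1 + s) <= s.
Proof. by rewrite -mulrA ler_pdivrMl // [leRHS]mulrC mulrA. Qed.

(** Grouping by [#|S| = i + 2], [F_bound] bounds each group by [(k * r) ^+ i.+1], and the geometric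
    estimate applies. *)
Lemma rooted_tail_le W v : W `<=` V -> v \in W ->
  \sum_(S <- fpowerset W | (v \in S) && (S != [fset v]))
     `|(F S)`_1| * k ^+ (#|` S|.-1) <= s.
Proof.
move=> WV vW; have vV : v \in V by exact: (fsubsetP WV).
have := @geometric_tail_le C (k * r) s #|` V| _ s_ge0 kr_le.
rewrite mulr_ge0 ?(ltW r_gt0) // => /(_ isT); apply: le_trans.
pose N := #|` V|.
(* Exactly one index [i] fits each [S], because [2 <= #|S| <= N]. *)
have -> : \sum_(S <- fpowerset W | (v \in S) && (S != [fset v]))
     `|(F S)`_1| * k ^+ (#|` S|.-1) =
   \sum_(S <- fpowerset W | (v \in S) && (S != [fset v]))
     \sum_(i < N | #|` S| == i.+2) `|(F S)`_1| * k ^+ i.+1.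
  rewrite [LHS]big_seq_cond [RHS]big_seq_cond.
  apply: eq_bigr => S /andP[]; rewrite fpowersetE => SW /andP[vS Sv].
  have S2 : (1 < #|` S|)%N.
    rewrite (cardfsD1 v) vS ltnS cardfs_gt0.
    by rewrite fsetD_eq0 fsubset1 negb_or Sv; apply/fset0Pn; exists v.
  have SN : (#|` S|.-2 < N)%N.
    apply: leq_trans (fsubset_leq_card (fsubset_trans SW WV)).
    by case: #|` S| S2 => [|[]].
  rewrite (big_pred1 (Ordinal SN)) => [|i].
    by congr (_ * _ ^+ _) => /=; case: #|` S| S2 => [|[]].
  rewrite /= -[i == _]val_eqE /=; case: #|` S| S2 => [|[|m]] // _.
  by rewrite !eqSS eq_sym.
rewrite (exchange_big_dep predT) //=; apply: ler_sum => i _.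
rewrite -mulr_suml mulrC exprMn ler_wpM2l ?exprn_ge0 //.
have := @F_bound _ vV i.+2 isT; rewrite subSS subn0; apply: le_trans.
rewrite (big_fpowerset_sub _ _ WV) [leLHS]big_mkcond [leRHS]big_mkcond /=.
apply: ler_sum => S _.
case: (v \in S) => //=; case: (#|` S| == i.+2); rewrite ?andbF ?andbT //=.
by case: ifP.
Qed.

(** The elements of [S] are removed one at a time, each costing a factor [k]. *)
Lemma removal_le (g : {fset U} -> C) T S :
  (forall T' u, T' `<=` T -> u \in T' -> g (T' `\ u) <= k * g T') ->
  S `<=` T -> g (T `\` S) <= k ^+ #|` S| * g T.
Proof.
move=> gk; have [n] := ubnP #|` S|; elim: n S => // n IHn S.
rewrite ltnS => leS ST.
have [->|/fset0Pn[u uS]] := eqVneq S fset0.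
  by rewrite fsetD0 cardfs0 mul1r.
have uT := fsubsetP ST _ uS.
have cS : #|` S| = #|` S `\ u|.+1 by rewrite (cardfsD1 u) uS.
have -> : T `\` S = (T `\` (S `\ u)) `\ u.
  by rewrite fsetDDl fsetUC fsetD1K.
apply: le_trans (gk _ u (fsubsetDl _ _) _) _; first by rewrite !inE eqxx.
rewrite cS exprS -mulrA ler_wpM2l // IHn -?cS //.
exact: fsubset_trans (fsubD1set _ _) ST.
Qed.

Lemma removal_ratio_le W v : W `<=` V -> v \in W ->
  `|(F (W `\ v)).[z]| <= k * `|(F W).[z]|.
Proof.
have [n] := ubnP #|` W|; elim: n W v => // n IHn W v.
rewrite ltnS => leW WV vW.
have cW : #|` W| = #|` W `\ v|.+1 by rewrite (cardfsD1 v) vW.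
rewrite ler_pdivlMl // [in leRHS](binomial_rooted WV vW).
rewrite hornerM hornerX normrM (mulrC (1 - s)) -mulrA ler_wpM2l //.
rewrite big_fset_condE (big_fsetD1 [fset v]) /=; last first.
  by rewrite !inE fpowersetE fsub1set vW eqxx.
rewrite F_fset1 ?(fsubsetP WV) // scale1r hornerD horner_sum.
set B := \sum_(S <- _) _; set A := (F _).[z].
(* [A] is the term of [[fset v]] and [B] the rest; the reverse triangle inequality then gives the
   bound. *)
suff BA : `|B| <= s * `|A|.
  apply: le_trans (lerB_normD _ _).
  by rewrite mulrBl mul1r lerD2l lerN2.
apply: le_trans (ler_norm_sum _ _ _) _.
apply: (@le_trans _ _ (\sum_(S <- fpowerset W | (v \in S) && (S != [fset v]))
     `|(F S)`_1| * k ^+ (#|` S|.-1) * `|A|)); last first.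
  by rewrite -mulr_suml ler_wpM2r // rooted_tail_le.
have -> : [fset S in fpowerset W | v \in S] `\ [fset v] =
          [fset S in fpowerset W | (v \in S) && (S != [fset v])].
  by apply/fsetP => S; rewrite !inE andbC andbA.
rewrite -big_fset_condE big_seq_cond [leRHS]big_seq_cond.
apply: ler_sum => S /andP[]; rewrite fpowersetE => SW /andP[vS Sv].
rewrite hornerZ normrM -mulrA ler_wpM2l //.
have cS : #|` S|.-1 = #|` S `\ v| by rewrite (cardfsD1 v S) vS.
have -> : W `\` S = (W `\ v) `\` (S `\ v) by rewrite fsetDDl fsetD1K.
(* Only [#|S| - 1] vertices leave [W] minus [v], whose subsets are all smaller than [W], so
   induction applies. *)
rewrite cS; apply: (@removal_le (fun T => `|(F T).[z]|)) => [T u TW uT|].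
  apply: IHn => //; last first.
    exact: fsubset_trans (fsubset_trans TW (fsubD1set _ _)) WV.
  by apply: leq_trans leW; rewrite cW ltnS fsubset_leq_card.
exact: fsetSD.
Qed.

(** By the ratio bound a root would persist after removing a vertex, hence descend to
    [F fset0 = 1]. *)
Lemma binomial_root_free W : W `<=` V -> ~~ root (F W) z.
Proof.
have [n] := ubnP #|` W|; elim: n W => // n IHn W.
rewrite ltnS => leW WV; rewrite rootE.
have [->|/fset0Pn[v vW]] := eqVneq W fset0.
  by rewrite F_fset0 hornerC oner_neq0.
apply/negP => /eqP FW0; have := removal_ratio_le WV vW.
rewrite FW0 normr0 mulr0 normr_le0; apply/negP/IHn.
  by apply: leq_trans leW; rewrite (cardfsD1 v W) vW.
exact: fsubset_trans (fsubD1set _ _) WV.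
Qed.

End ZeroFree.

End BinomialFamily.

(** * Induced subgraphs and the transfer to graphs *)

Section InducedSubgraphs.
Variable U : choiceType.
Implicit Types (G : sgraph U) (S W : {fset U}).

Lemma sgraph_eq G1 G2 : vset G1 = vset G2 -> eset G1 = eset G2 -> G1 = G2.
Proof.
case: G1 G2 => V1 E1 p1 [V2 E2 p2] /= eV eE; subst V2 E2.
by rewrite (bool_irrelevance p1 p2).
Qed.

Lemma vset_induced G W : W `<=` vset G -> vset (induced G W) = W.
Proof. by move=> WV /=; apply/fsetIidPr. Qed.

Lemma induced_vset G : induced G (vset G) = G.
Proof.
apply: sgraph_eq; first exact: vset_induced.
apply/fsetP => e; rewrite !inE; case: (boolP (e \in eset G)) => //.
by move=> /esetP/andP[->].
Qed.

Lemma induced_fset0 G : induced G fset0 = empty_graph U.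
Proof.
apply: sgraph_eq; first exact: fsetI0.
apply/fsetP => e; rewrite !inE; apply/negP => /andP[/esetP/andP[_ e2]].
by rewrite fsubset0 => /eqP e0; rewrite e0 cardfs0 in e2.
Qed.

Lemma induced_induced G W S :
  S `<=` W -> induced (induced G W) S = induced G S.
Proof.
move=> SW; apply: sgraph_eq => /=; apply/fsetP => x; rewrite !inE.
  by case: (boolP (x \in S)) => [/(fsubsetP SW) ->|]; rewrite ?andbT ?andbF.
case: (boolP (x `<=` S)) => [xS|]; last by rewrite !andbF.
by rewrite (fsubset_trans xS SW) !andbT.
Qed.

End InducedSubgraphs.

Theorem theorem1p6 (R : realType) :
  exists c : R, c < 704%:R / 100%:R /\
    forall (U : choiceType) (f : graph_polynomial R U) (rho : nat -> R),
      bounded_exponential_type f rho ->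
      (forall D : nat, 0 < rho D) ->
      forall (D : nat) (G : sgraph U), degrees_le G D ->
      forall z : R[i], root (f G) z -> `|z| < (c * rho D)%:C.
Proof.
exists 6%:R; split; first by rewrite ltr_pdivlMr ?ltr0n // -natrM ltr_nat.
move=> U f rho [f_monic [f_empty f_exp] _ f_bound] rho_gt0 D G degG z.
rewrite -{1}(induced_vset G); apply: contraTT => z_large.
have norm_ge : (6%:R * rho D)%:C <= `|z|.
  (* The order on [R[i]] is partial, so negating the strict inequality requires both sides to be
     real. *)
  rewrite real_leNgt // ?normr_real // ger0_real // lecR.
  by rewrite mulr_ge0 ?ler0n // ltW.
apply: (@binomial_root_free _ U (fun S => f (induced G S)) (vset G)
  _ _ (rho D)%:C z (2%:R^-1)) => //=.
- by rewrite induced_fset0.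
- move=> W WV x y; have := f_exp (induced G W) x y.
  rewrite vset_induced // => <-; rewrite big_seq [RHS]big_seq.
  apply: eq_bigr => S; rewrite fpowersetE => SW.
  by rewrite !induced_induced // fsubsetDl.
(* On a single vertex the polynomial is monic of degree one, so its linear coefficient is the
   leading one. *)
- move=> v vV; have [/monicP + size_f] := f_monic (induced G [fset v]).
  by rewrite lead_coefE size_f vset_induced ?fsub1set // cardfs1.
- by rewrite ltcR.
- by move=> v vV t t1; rewrite -rmorphXn /=; exact: f_bound.
- by rewrite invr_ge0 ler0n.
- by rewrite invf_lt1 ?ltr0n // ltr1n.
- by apply: half_scaled_le; rewrite -(rmorph_nat (real_complex R)) -rmorphM.
Qed.
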